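(* Let $T>0$, let $\bar\lambda:=\inf\{\lambda : \lambda\in\sigma(A)\}$, let $\gamma$ be a positive parameter with $\gamma<2\exp(\bar\lambda^2T)$, and let $T_{l,p}:H\to H$ be the linear operator $T_{l,p}\varphi:=(I-\gamma\exp(-A^2T))\varphi$. Then $T_{l,p}$ is self-adjoint, non-expansive and regular asymptotic in $H$, and $1$ is not an eigenvalue of $T_{l,p}$. Further, if it is possible to choose $\gamma$ such that $\gamma<2\exp(\tilde\lambda^2T)$, where $\tilde\lambda:=(\bar\lambda^2-T^{-1}\ln2)^{1/2}$, then (for $\gamma$ so chosen) $T_{l,p}$ is also injective.
   Context: Let $\Omega\subset\mathbb{R}^n$ be an open, bounded set with smooth boundary and let $A$ be a positive ($\langle A\varphi,\varphi\rangle>0$ for $0\neq\varphi$ in the domain of $A$), self-adjoint, unbounded operator with discrete spectrum, densely defined on the Hilbert space $H:=L^2(\Omega)$; $\sigma(A)$ denotes its spectrum. Functions of $A$ such as $\exp(-A^2T)$ are defined by the spectral calculus of $A$. A linear operator $S$ on a Hilbert space $X$ is non-expansive if $\|S\|\le 1$, and it is regular asymptotic in $X$ if $\|S^{k+1}x-S^kx\|\to 0$ as $k\to\infty$ for every $x\in X$. *)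

(* Defs.v *)
From HB Require Import structures.
From mathcomp Require Import all_boot all_order all_algebra.
From mathcomp Require Import all_classical all_reals all_analysis.
From mathcomp Require Import measurable_realfun.

Set Implicit Arguments.
Unset Strict Implicit.
Unset Printing Implicit Defensive.
Import Order.TTheory GRing.Theory Num.Theory.
Import numFieldNormedType.Exports.
Local Open Scope classical_set_scope.
Local Open Scope ring_scope.

(* The sigma-algebra on 'rV[R]_n is the product one, generated by the         *)
(* coordinates.  It contains the open sets (lemma open_measurable_rV), so it  *)
(* is the Borel sigma-algebra.                                                *)
Definition rV_display : measure_display.
Proof. exact: default_measure_display. Qed.

Section measurable_rV.
Context (R : realType) (n : nat).

Let coord (i : 'I_n) (v : 'rV[R]_n) : measurableTypeR R := v 0 i.

Let rV_set0 : g_sigma_preimage coord set0.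
Proof. exact: sigma_algebra0. Qed.

Let rV_setC A : g_sigma_preimage coord A -> g_sigma_preimage coord (~` A).
Proof. exact: sigma_algebraC. Qed.

Let rV_bigcup (F : _^nat) : (forall i, g_sigma_preimage coord (F i)) ->
  g_sigma_preimage coord (\bigcup_i (F i)).
Proof. exact: sigma_algebra_bigcup. Qed.

HB.instance Definition _ := @isMeasurable.Build rV_display
  'rV[R]_n (g_sigma_preimage coord) rV_set0 rV_setC rV_bigcup.

Lemma measurable_rV_coord (i : 'I_n) :
  measurable_fun setT (fun v : 'rV[R]_n => v 0 i : measurableTypeR R).
Proof.
move=> _ Y mY; rewrite setTI; apply: sub_sigma_algebra => /=.
rewrite -bigcup_seq/=; exists i => /=; first by rewrite mem_index_enum.
by exists Y => //; rewrite setTI.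
Qed.

Lemma measurable_fun_rV d (T : measurableType d) (f : T -> 'rV[R]_n) :
  (forall i, measurable_fun setT (fun x => f x 0 i : measurableTypeR R)) ->
  measurable_fun setT f.
Proof.
move=> mf.
suff : g_sigma_preimage (fun i => coord i \o f) `<=` measurable.
  by rewrite g_sigma_preimage_comp => pS _ A mA; apply: pS; exists A.
apply: smallest_sub; first exact: sigma_algebra_measurable.
move=> A; rewrite -bigcup_seq => -[i _ [B mB <-]].
exact: mf.
Qed.

Lemma open_measurable_rV (U : set 'rV[R]_n) : open U -> measurable U.
Proof.
move=> oU.
pose box (q : 'rV[rat]_n * nat) : set 'rV[R]_n :=
  \bigcap_(i in [set: 'I_n]) ((fun v : 'rV[R]_n => v 0 i) @^-1`
     ball (ratr (q.1 0 i) : R) (q.2.+1%:R^-1)).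
have mbox q : measurable (box q).
  apply: fin_bigcap_measurable => // i _.
  rewrite -[X in measurable X]setTI; apply: measurable_rV_coord => //.
  exact: measurable_ball.
have -> : U = \bigcup_(q in [set q | box q `<=` U]) box q.
  apply/seteqP; split => [v Uv|v [q /= qU qv]]; last exact: qU.
  have /nbhs_ballP[e /= e0 eU] : nbhs v U by exact: open_nbhs_nbhs.
  have [k ke] : exists k : nat, (k.+1%:R^-1 : R) < e / 2.
    exists (Num.truncn (e / 2)^-1).
    by rewrite invf_plt ?posrE ?divr_gt0// truncnS_gt.
  have qex (i : 'I_n) : exists q : rat, `|v 0 i - ratr q| < k.+1%:R^-1.
    have /rat_in_itvoo[q] : v 0 i - k.+1%:R^-1 < v 0 i + k.+1%:R^-1.
      by rewrite ltrBlDr -addrA ltrDl addr_gt0// invr_gt0.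
    by rewrite in_itv/= => qi; exists q; rewrite distrC ltr_distl.
  pose q := \row_i (projT1 (cid (qex i))) : 'rV[rat]_n.
  have qv (i : 'I_n) : `|v 0 i - ratr (q 0 i)| < k.+1%:R^-1.
    by rewrite mxE; exact: (projT2 (cid (qex i))).
  exists (q, k) => /=; last by move=> i _; rewrite /ball/= distrC.
  move=> w qw; apply: eU; split => // i j; rewrite (ord1 i).
  have := qw j I; rewrite /= /ball/= => wj.
  have -> : v 0 j - w 0 j =
      (v 0 j - ratr (q 0 j)) + (ratr (q 0 j) - w 0 j) by rewrite addrA subrK.
  rewrite (le_lt_trans (ler_normD _ _))// [ltRHS]splitr ltrD//.
  - exact: lt_trans (qv j) ke.
  - exact: lt_trans wj ke.
rewrite bigcup_mkcond; apply: countable_bigcupT_measurable => // q.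
by case: ifP.
Qed.

End measurable_rV.

Section lebesgue_measure_rV.
Context (R : realType).

Definition rV_cons n (p : measurableTypeR R * 'rV[R]_n) : 'rV[R]_n.+1 :=
  \row_i oapp (p.2 0) p.1 (unlift ord0 i).

Lemma measurable_rV_cons n : measurable_fun setT (@rV_cons n).
Proof.
apply: measurable_fun_rV => i.
case: (unliftP ord0 i) => [j ->|->].
- rewrite (_ : (fun _ => _) = (fun v : 'rV[R]_n => v 0 j) \o snd).
    exact: measurableT_comp (measurable_rV_coord j) measurable_snd.
  by apply/funext => p; rewrite mxE liftK.
- rewrite (_ : (fun _ => _) = fst); first exact: measurable_fst.
  by apply/funext => p; rewrite mxE unlift_none.
Qed.

Section step.
Context (n : nat) (m : {sigma_finite_measure set 'rV[R]_n -> \bar R}).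

Definition rV_step : set 'rV[R]_n.+1 -> \bar R :=
  pushforward (lebesgue_measure \x m)%E (@rV_cons n).

Let mpre A : measurable A -> measurable (@rV_cons n @^-1` A).
Proof.
by move=> mA; rewrite -[X in measurable X]setTI; exact: measurable_rV_cons.
Qed.

Let rV_step0 : rV_step set0 = 0%E.
Proof. by rewrite /rV_step /pushforward preimage_set0 measure0. Qed.

Let rV_step_ge0 A : (0 <= rV_step A)%E.
Proof. by apply: integral_ge0 => *; exact: measure_ge0. Qed.

Let rV_step_sigma_additive : semi_sigma_additive rV_step.
Proof.
move=> F mF tF mUF; rewrite /rV_step /pushforward preimage_bigcup.
apply: measure_semi_sigma_additive.
- by move=> k; exact: mpre.
- apply/trivIsetP => i j _ _ ij; rewrite -preimage_setI.
  by move/trivIsetP : tF => /(_ _ _ _ _ ij) ->//; rewrite preimage_set0.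
- by rewrite -preimage_bigcup; exact: mpre.
Qed.

HB.instance Definition _ := isMeasure.Build _ _ _ rV_step
  rV_step0 rV_step_ge0 rV_step_sigma_additive.

Let rV_step_sigma_finite : sigma_finite setT rV_step.
Proof.
pose u (v : 'rV[R]_n.+1) : measurableTypeR R * 'rV[R]_n :=
  (v 0 ord0, \row_j v 0 (lift ord0 j)).
have uK : cancel (@rV_cons n) u.
  move=> [x w]; rewrite /u; congr pair; first by rewrite mxE unlift_none.
  by apply/rowP => j; rewrite !mxE liftK.
have mu : measurable_fun setT u.
  apply/measurable_fun_pair; first exact: measurable_rV_coord.
  apply: measurable_fun_rV => i.
  rewrite (_ : (fun _ => _) = fun v : 'rV[R]_n.+1 => v 0 (lift ord0 i)).
    exact: measurable_rV_coord.
  by apply/funext => v; rewrite mxE.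
have [G GT Gfin] : sigma_finite setT (lebesgue_measure \x m)%E.
  have /sigma_finiteP[F [TF ndF Foo]] := sigma_finiteT (@lebesgue_measure R).
  have /sigma_finiteP[H [TH ndH Hoo]] := sigma_finiteT m.
  exists (fun k => F k `*` H k).
    rewrite -setXTT TF TH predeqE => -[x y]; split.
      move=> [/= [k _ Fkx] [l _ Hly]]; exists (maxn k l) => //; split.
      - by move: x Fkx; exact/subsetPset/ndF/leq_maxl.
      - by move: y Hly; exact/subsetPset/ndH/leq_maxr.
    by move=> [k _ []/= ? ?]; split; exists k.
  move=> k; have [? ?] := Foo k; have [? ?] := Hoo k.
  split; first exact: measurableX.
  by rewrite product_measure1E// lte_mul_pinfty// ge0_fin_numE.
exists (fun k => u @^-1` G k).
  by rewrite -preimage_bigcup -GT preimage_setT.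
move=> k; have [mG Gk] := Gfin k; split.
  by rewrite -[X in measurable X]setTI; exact: mu.
rewrite /rV_step /pushforward -comp_preimage.
by rewrite (_ : u \o _ = id) ?preimage_id//; apply/funext => x /=; exact: uK.
Qed.

HB.instance Definition _ := @Measure_isSigmaFinite.Build _ _ _ rV_step
  rV_step_sigma_finite.

End step.

(* Lebesgue measure on R^n, by recursion on n: unit mass on R^0, then the     *)
(* product with one-dimensional Lebesgue measure.                             *)
Fixpoint lebesgue_rV n : {sigma_finite_measure set 'rV[R]_n -> \bar R} :=
  match n with
  | 0 => \d_(0 : 'rV[R]_0)
  | n.+1 => rV_step (lebesgue_rV n)
  end.

End lebesgue_measure_rV.

HB.mixin Record isInnerProduct (R : realType) (V : Type) & GRing.Lmodule R V := {
  inner : V -> V -> R ;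
  innerC : forall x y, inner x y = inner y x ;
  innerP : forall (a : R) x y z, inner (a *: x + y) z = a * inner x z + inner y z ;
  inner_ge0 : forall x, 0 <= inner x x ;
  inner_eq0 : forall x, inner x x = 0 -> x = 0
}.

#[short(type="innerProductType")]
HB.structure Definition InnerProduct (R : realType) :=
  {V of GRing.Lmodule R V & isInnerProduct R V}.

Notation "''<' x , y >" := (inner x y) (at level 2, x at level 69, y at level 69,
  format "''<' x ,  y >") : ring_scope.

Section L2.
Context d (T : measurableType d) (R : realType).
Variable mu : {measure set T -> \bar R}.
Local Open Scope quotient_scope.

(* The library's L^2 space, i.e. a.e. classes of square integrable functions. *)
Definition L2 : Type := LspaceType2 mu.

HB.instance Definition _ := gen_eqMixin L2.
HB.instance Definition _ := gen_choiceMixin L2.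

Definition L2_fun (F : L2) : T -> R := LebesgueSpace.sort F.

Let L2_mfun (F : L2) : measurable_fun setT (L2_fun F).
Proof. exact: (measurable_funPT (repr (LebesgueSpace.sort F))). Qed.

Lemma L2_funP (F : L2) : L2_fun F \in Lfun mu 2%:R%:E.
Proof.
rewrite inE; apply/andP; split; rewrite inE/=; first exact: L2_mfun.
exact: (@Lebesgue_finite _ _ _ _ _ _ F).
Qed.

Lemma L2_fun_inj (F G : L2) : L2_fun F = L2_fun G %[ae mu] -> F = G.
Proof.
case: F G => [f [[fP]]] [g [[gP]]] fg.
have fgE : f = g.
  by rewrite -[f]reprK -[g]reprK; apply/eqmodP/asboolP; exact: fg.
subst g; congr (LebesgueSpace.Pack (LebesgueSpace.Class _)).
by congr isFinLebesgue.Axioms_; exact: Prop_irrelevance.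
Qed.

Section L2_of.
Context (f : T -> R) (fP : f \in Lfun mu 2%:R%:E).

Let mf : @measurable_fun _ _ T (measurableTypeR R) setT f.
Proof. by move: fP; rewrite inE => /andP[]; rewrite inE. Qed.

Let g : {mfun T >-> measurableTypeR R} :=
  HB.pack_for {mfun T >-> measurableTypeR R} f
    (isMeasurableFun.Build _ _ T (measurableTypeR R) f mf).

Let cls : {mfun_ mu, T >-> measurableTypeR R} := \pi g.

Let clsE : f = cls %[ae mu].
Proof.
have /asboolP : ae_eq_op mu g (repr cls) by apply/eqmodP; rewrite reprK.
exact.
Qed.

Let cls_fin : finite_norm mu 2%:R%:E cls.
Proof.
move: fP; rewrite inE => /andP[_]; rewrite inE/= /finite_norm unlock.
have mnorm (h : T -> R) : measurable_fun setT h ->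
    measurable_fun setT (fun x => (`|(EFin \o h) x| `^ 2%:R)%E).
  move=> mh; apply/measurable_EFinP => /=.
  apply: (measurableT_comp (measurable_powR _)) => //.
  exact: measurableT_comp.
rewrite (ge0_ae_eq_integral (g := fun x => (`|(EFin \o cls) x| `^ 2%:R)%E))//.
- exact: mnorm.
- exact/mnorm/(measurable_funPT (repr cls)).
- by move=> x _; exact: poweR_ge0.
- by move=> x _; exact: poweR_ge0.
- by apply: filterS clsE => x fx _ /=; rewrite fx.
Qed.

Definition L2_of : L2 := HB.pack_for (LspaceType2 mu) cls
  (isFinLebesgue.Build d T R mu 2%:R%:E (lee1n 2) cls cls_fin).

Lemma L2_ofE : L2_fun L2_of = f %[ae mu].
Proof. by apply: ae_eq_sym. Qed.

End L2_of.

Let L2_closed a (F G : L2) : a *: L2_fun F + L2_fun G \in Lfun mu 2%:R%:E.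
Proof.
have [_] := @Lfun_submod_closed _ _ _ mu _ (lee1n 2).
by apply; exact: L2_funP.
Qed.

Let zero_closed : 0 \in Lfun mu 2%:R%:E.
Proof. by have [] := @Lfun_submod_closed _ _ _ mu _ (lee1n 2). Qed.

Let L2_0 : L2 := L2_of zero_closed.
Let L2_lin a (F G : L2) : L2 := L2_of (L2_closed a F G).
Let L2_add := L2_lin 1.
Let L2_opp F := L2_lin (-1) F L2_0.
Let L2_scale a F := L2_lin a F L2_0.

Let linE a F G : \forall x \ae mu, L2_fun (L2_lin a F G) x = a * L2_fun F x + L2_fun G x.
Proof. by apply: filterS (L2_ofE (L2_closed a F G)) => x; exact. Qed.

Let zeroE : \forall x \ae mu, L2_fun L2_0 x = 0.
Proof. by apply: filterS (L2_ofE zero_closed) => x; exact. Qed.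

Let aeP F G : (\forall x \ae mu, L2_fun F x = L2_fun G x) -> F = G.
Proof. by move=> FG; apply: L2_fun_inj; apply: filterS FG. Qed.

Let oppE F : \forall x \ae mu, L2_fun (L2_opp F) x = - L2_fun F x.
Proof.
by apply: filterS2 (linE (-1) F L2_0) zeroE => x -> ->; rewrite addr0 mulN1r.
Qed.

Let scaleE a F : \forall x \ae mu, L2_fun (L2_scale a F) x = a * L2_fun F x.
Proof. by apply: filterS2 (linE a F L2_0) zeroE => x -> ->; rewrite addr0. Qed.

Let addE F G : \forall x \ae mu, L2_fun (L2_add F G) x = L2_fun F x + L2_fun G x.
Proof. by apply: filterS (linE 1 F G) => x ->; rewrite mul1r. Qed.

Let L2_addA : associative L2_add.
Proof.
move=> F G H; apply: aeP.
apply: filterS3 (addE F G) (addE G H)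
  (filterI (addE F (L2_add G H)) (addE (L2_add F G) H)).
by move=> x fg gh [-> ->]; rewrite fg gh addrA.
Qed.

Let L2_addC : commutative L2_add.
Proof.
move=> F G; apply: aeP.
by apply: filterS2 (addE F G) (addE G F) => x -> ->; rewrite addrC.
Qed.

Let L2_add0 : left_id L2_0 L2_add.
Proof.
move=> F; apply: aeP.
by apply: filterS2 (addE L2_0 F) zeroE => x -> ->; rewrite add0r.
Qed.

Let L2_addN : left_inverse L2_0 L2_opp L2_add.
Proof.
move=> F; apply: aeP.
apply: filterS3 (addE (L2_opp F) F) zeroE (oppE F).
by move=> x -> -> ->; rewrite addNr.
Qed.

HB.instance Definition _ := GRing.isZmodule.Build L2
  L2_addA L2_addC L2_add0 L2_addN.

Let L2_scaleA a b F : L2_scale a (L2_scale b F) = L2_scale (a * b) F.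
Proof.
apply: aeP.
apply: filterS3 (scaleE a (L2_scale b F)) (scaleE b F) (scaleE (a * b) F).
by move=> x -> -> ->; rewrite mulrA.
Qed.

Let L2_scale1 : left_id 1 L2_scale.
Proof. by move=> F; apply: aeP; apply: filterS (scaleE 1 F) => x ->; rewrite mul1r. Qed.

Let L2_scaleDr : right_distributive L2_scale +%R.
Proof.
move=> a F G; apply: aeP.
apply: filterS3 (filterI (scaleE a F) (scaleE a G)) (scaleE a (F + G))
  (filterI (addE F G) (addE (L2_scale a F) (L2_scale a G))).
by move=> x [fE gE] -> [-> ->]; rewrite fE gE mulrDr.
Qed.

Let L2_scaleDl F : {morph L2_scale^~ F : a b / a + b}.
Proof.
move=> a b; apply: aeP.
apply: filterS3 (filterI (scaleE a F) (scaleE b F)) (scaleE (a + b) F)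
  (addE (L2_scale a F) (L2_scale b F)).
by move=> x [fE gE] -> ->; rewrite fE gE mulrDl.
Qed.

HB.instance Definition _ := GRing.Zmodule_isLmodule.Build R L2
  L2_scaleA L2_scale1 L2_scaleDr L2_scaleDl.

Lemma L2_addE (F G : L2) : L2_fun (F + G) = L2_fun F \+ L2_fun G %[ae mu].
Proof. by apply: filterS (addE F G). Qed.

Lemma L2_scalE a (F : L2) : L2_fun (a *: F) = a \*o L2_fun F %[ae mu].
Proof. by apply: filterS (scaleE a F). Qed.

Definition L2_inner (F G : L2) : R := \int[mu]_x (L2_fun F x * L2_fun G x).

Let L2_integrable (F G : L2) :
  mu.-integrable setT (EFin \o (fun x => L2_fun F x * L2_fun G x)).
Proof.
exact/Lfun1_integrable/(Lfun2_mul_Lfun1 (L2_funP F) (L2_funP G)).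
Qed.

Let L2_innerC F G : L2_inner F G = L2_inner G F.
Proof. by apply: eq_Rintegral => x _; rewrite mulrC. Qed.

Let L2_innerP a F G H :
  L2_inner (a *: F + G) H = a * L2_inner F H + L2_inner G H.
Proof.
have iaF : mu.-integrable setT (EFin \o (fun x => a * (L2_fun F x * L2_fun H x))).
  exact: (integrableZl measurableT a (L2_integrable F H)).
rewrite /L2_inner -RintegralZl// -RintegralD//.
congr fine; apply: ae_eq_integral => //.
- exact: measurable_int (L2_integrable _ _).
- exact: measurable_int (integrableD measurableT iaF (L2_integrable G H)).
apply: filterS2 (addE (a *: F) G) (scaleE a F) => x aFG aF _ /=.
by rewrite [L2_fun (a *: F + G) x]aFG [L2_fun (a *: F) x]aF mulrDl mulrA.
Qed.

Let L2_inner_ge0 F : 0 <= L2_inner F F.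
Proof. by apply: Rintegral_ge0 => x _; rewrite -expr2 sqr_ge0. Qed.

Let L2_inner_eq0 F : L2_inner F F = 0 -> F = 0.
Proof.
move=> FF0; have iFF := L2_integrable F F.
have : (\int[mu]_x `|(L2_fun F x * L2_fun F x)%:E| = 0)%E.
  rewrite -[RHS]/(0 : R)%:E -FF0 /L2_inner /Rintegral fineK.
    by apply: eq_integral => x _; rewrite gee0_abs// lee_fin -expr2 sqr_ge0.
  exact: integrable_fin_num.
move/(ae_eq_integral_abs mu measurableT (measurable_int mu iFF)) => F0.
apply: aeP; apply: filterS2 F0 zeroE => x /= Fx F0x.
rewrite [RHS]F0x; have [/eqP] := Fx Logic.I.
by rewrite mulf_eq0 orbb => /eqP.
Qed.

HB.instance Definition _ := isInnerProduct.Build R L2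
  L2_innerC L2_innerP L2_inner_ge0 L2_inner_eq0.

End L2.

Section smooth_boundary.
Context (R : realType) (n : nat).
Implicit Types (f : 'rV[R]_n -> R) (U : set 'rV[R]_n).

Definition partial (i : 'I_n) f : 'rV[R]_n -> R := 'D_(delta_mx 0 i) f.

Definition partials (s : seq 'I_n) f : 'rV[R]_n -> R := foldr partial f s.

Definition smooth_on U f :=
  forall (s : seq 'I_n) (x : 'rV[R]_n), U x ->
    {for x, continuous (partials s f)} /\
    forall i, derivable (partials s f) x (delta_mx 0 i).

(* Near each of its boundary points the open set Omega is the sublevel set    *)
(* {rho < 0} of a smooth rho without critical points.                         *)
Definition smooth_boundary (Omega : set 'rV[R]_n) :=
  forall x, (closure Omega `\` interior Omega) x ->
    exists (U : set 'rV[R]_n) (rho : 'rV[R]_n -> R),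
      [/\ open U, U x, smooth_on U rho,
          forall y, U y -> exists i, partial i rho y != 0 &
          Omega `&` U = [set y | rho y < 0] `&` U].

End smooth_boundary.

Definition L2_open (R : realType) (n : nat) (Omega : set 'rV[R]_n)
    (oOmega : open Omega) : innerProductType R :=
  L2 (mrestr (@lebesgue_rV R n) (open_measurable_rV oOmega)).

(* An unbounded operator is given by its domain D and a function A on the     *)
(* whole space, whose values outside D are irrelevant.                        *)
Section operators.
Context (R : realType) (H : innerProductType R).
Implicit Types (D : set H) (A S : H -> H) (l : R) (x y z : H).

Definition hnorm x : R := Num.sqrt '<x, x>.

Definition linear_on D A :=
  D 0 /\ forall (a : R) x y, D x -> D y ->
    D (a *: x + y) /\ A (a *: x + y) = a *: A x + A y.

Definition densely_defined D :=
  forall x (e : R), 0 < e -> exists2 y, D y & hnorm (x - y) < e.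

Definition adjoint_graph D A y z := forall x, D x -> '<A x, y> = '<x, z>.

Definition self_adjoint D A :=
  [/\ linear_on D A, densely_defined D &
      forall y z, adjoint_graph D A y z <-> D y /\ z = A y].

Definition positive_operator D A := forall x, D x -> x != 0 -> 0 < '<A x, x>.

Definition bounded_on D A :=
  exists C : R, forall x, D x -> hnorm (A x) <= C * hnorm x.

Definition resolvent_set D A : set R := [set l | exists B : H -> H,
  [/\ forall y, D (B y) /\ A (B y) - l *: B y = y,
      forall x, D x -> B (A x - l *: x) = x & bounded_on setT B]].

Definition spectrum D A : set R := ~` resolvent_set D A.

Definition eigenvector D A l x := D x /\ A x = l *: x.

Definition eigenvalue_of D A l := exists2 x, x != 0 & eigenvector D A l x.

Definition finite_multiplicity D A l :=
  exists (m : nat) (e : 'I_m -> H), forall x, eigenvector D A l x ->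
    exists c : 'I_m -> R, x = \sum_i c i *: e i.

Definition discrete_spectrum D A := forall l, spectrum D A l ->
  [/\ isolated (spectrum D A) l, eigenvalue_of D A l & finite_multiplicity D A l].

Definition opnorm S : \bar R :=
  ereal_sup [set (hnorm (S x))%:E | x in [set x | hnorm x <= 1]].

Definition non_expansive S := linear_on setT S /\ (opnorm S <= 1)%E.

Definition regular_asymptotic S := linear_on setT S /\
  forall x, (fun k => hnorm (iter k.+1 S x - iter k S x)) @ \oo --> (0 : R).

(* Resolutions of the identity, as projection-valued measures on the Borel    *)
(* sets of the line. For a projection, '<E(B) x, x> = '<E(B) x, E(B) x>.      *)
Record resolution_of_identity := {
  pvm :> set (measurableTypeR R) -> H -> H ;
  pvm_self_adjoint : forall B, measurable B -> self_adjoint setT (pvm B) ;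
  pvm0 : forall x, pvm set0 x = 0 ;
  pvmT : forall x, pvm setT x = x ;
  pvmI : forall B C, measurable B -> measurable C ->
    forall x, pvm (B `&` C) x = pvm B (pvm C x) ;
  pvm_sigma_additive : forall x,
    semi_sigma_additive (fun B => '<pvm B x, pvm B x>%:E) }.

Implicit Types (E : resolution_of_identity) (f : R -> R).

Definition spectral_measure E x : set (measurableTypeR R) -> \bar R :=
  fun B => '<E B x, E B x>%:E.

Section measure.
Context E x.

Let spectral_measure0 : spectral_measure E x set0 = 0%E.
Proof.
rewrite /spectral_measure pvm0; congr EFin.
by have := innerP (-1) (0 : H) 0 0; rewrite scaler0 addr0 mulN1r addNr.
Qed.

Let spectral_measure_ge0 B : (0 <= spectral_measure E x B)%E.
Proof. by rewrite lee_fin inner_ge0. Qed.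

HB.instance Definition _ := isMeasure.Build _ _ _ (spectral_measure E x)
  spectral_measure0 spectral_measure_ge0 (@pvm_sigma_additive E x).

End measure.

(* The integral of f against d<E x, z>, by polarization. *)
Definition spectral_form E f x z : R :=
  (\int[spectral_measure E (x + z)]_s f s -
   \int[spectral_measure E (x - z)]_s f s) / 4.

(* The operator \int f dE: its domain, its graph, and its values (the value   *)
(* at x is the only y such that the graph relation holds).                    *)
Definition spectral_dom E f : set H :=
  [set x | (\int[spectral_measure E x]_s (f s ^+ 2)%:E < +oo)%E].

Definition spectral_graph E f x y :=
  forall z, spectral_dom E f z -> '<y, z> = spectral_form E f x z.

Definition spectral_integral E f x : H :=
  xget 0 [set y | spectral_graph E f x y].

(* A = \int s dE(s). *)
Definition resolution_of D A E :=
  D = spectral_dom E id /\ forall x, D x -> spectral_graph E id x (A x).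

(* exp(- A^2 t), for the operator A with resolution of the identity E. *)
Definition exp_sqr E (t : R) : H -> H :=
  spectral_integral E (fun s => expR (- (s ^+ 2 * t))).

Definition T_lp E (t gamma : R) : H -> H :=
  fun phi => phi - gamma *: exp_sqr E t phi.

End operators.

(* Main.v *)
Require Import Defs.
From mathcomp Require Import all_boot all_order all_algebra.
From mathcomp Require Import all_classical all_reals all_analysis.
From mathcomp Require Import ring lra.
From mathcomp Require Import measurable_realfun.

Set Implicit Arguments.
Unset Strict Implicit.
Unset Printing Implicit Defensive.
Import Order.TTheory GRing.Theory Num.Theory.
Import numFieldNormedType.Exports.
Local Open Scope classical_set_scope.
Local Open Scope ring_scope.

(** Put S = gamma exp(- A^2 T), so that the operator under study is L = I - S.
    Everything follows from three facts about the quadratic form of S: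

      S is symmetric,   0 < <S x, x> for x <> 0,   <S x, x> <= c <x, x>

    with c = gamma exp(- lambda_bar^2 T) < 2. Applying Cauchy-Schwarz to the
    form of S gives |S x|^2 <= c <S x, x>, and expanding the square gives

      |L x|^2 <= |x|^2 - (2 - c) <S x, x>.

    This makes L a contraction. It also makes |L^k x|^2 decrease, so that its
    successive differences tend to 0; they dominate (2 - c) <S L^k x, L^k x>,
    hence also a multiple of |S L^k x|^2 = |L^(k+1) x - L^k x|^2, which is
    regular asymptoticity. A fixed point of L is killed by S, so strict
    positivity makes it 0. The second hypothesis on gamma says c < 1; then a
    vector killed by L satisfies <x, x> = <S x, x> <= c <x, x> and vanishes.

    Three ingredients produce these facts.

    - Existence of S. It is only specified by its sesquilinear form
      (spectral_form), so it comes from the Riesz representation theorem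
      (riesz_representation), which needs the completeness of L^2 (the
      Riesz-Fischer theorem, L2_rapidly_complete).

    - Bilinearity of the form (spectral_form_linear). The measures
      <E(B) x, x> depend quadratically on x, so the polarized set function is
      linear in x; collecting the terms by sign turns linearity into an
      equality of two sums of positive measures, which can be integrated.

    - The upper bound, which requires E to vanish below
      lambda_bar = inf sigma(A) (pvm_below_spectrum). Positivity of A kills
      E(]-oo, 0[). If M is the largest number with E(]-oo, M[) = 0 and M is in
      the resolvent set, put P(u, v) = <(A - M) u, v>, a nonnegative form on
      the domain. For y in the range of E([M, M + e[) and
      z = (A - M)^-1 y, Cauchy-Schwarz for P reads

        |y|^4 = P(y, z)^2 <= P(y, y) P(z, z) <= e |y|^2 . C |y|^2,

      with C a bound on (A - M)^-1, so y = 0 once e C < 1, contradicting the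
      choice of M. Hence M belongs to the spectrum and lambda_bar <= M. *)

(** * Inner products and the Riesz representation theorem *)

Section inner_product.
Context (R : realType) (H : innerProductType R).
Implicit Types (x y z : H) (a : R).

Lemma innerDl x y z : '<x + y, z> = '<x, z> + '<y, z>.
Proof. by have := innerP 1 x y z; rewrite scale1r mul1r. Qed.

Lemma inner0l z : '<0, z> = 0 :> R.
Proof. by apply: (addrI '<0, z>); rewrite -innerDl !addr0. Qed.

Lemma innerZl a x z : '<a *: x, z> = a * '<x, z>.
Proof. by have := innerP a x 0 z; rewrite addr0 inner0l addr0. Qed.

Lemma innerNl x z : '<- x, z> = - '<x, z>.
Proof. by rewrite -scaleN1r innerZl mulN1r. Qed.

Lemma innerDr x y z : '<z, x + y> = '<z, x> + '<z, y>.
Proof. by rewrite innerC innerDl !(innerC z). Qed.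

Lemma innerZr a x z : '<z, a *: x> = a * '<z, x>.
Proof. by rewrite innerC innerZl innerC. Qed.

Lemma innerNr x z : '<z, - x> = - '<z, x>.
Proof. by rewrite innerC innerNl innerC. Qed.

Definition innerE := (innerDl, innerDr, innerNl, innerNr, innerZl, innerZr).

(** The source of all Cauchy-Schwarz inequalities below: it applies to any
    nonnegative form, whether or not it is defined on the whole space. *)
Lemma quadratic_ge0 (a b c : R) :
  (forall t, 0 <= a + 2 * t * b + t ^+ 2 * c) -> b ^+ 2 <= a * c.
Proof.
move=> q.
have a0 : 0 <= a by have := q 0; lra.
have [c0|c0|c0] := ltgtP c 0.
- pose t := - (a / c) + 1.
  have t1 : 1 <= t by rewrite lerDr oppr_ge0 mulr_ge0_le0 // invr_le0 ltW.
  have tc : t * c = - a + c by rewrite /t mulrDl mulNr divfK ?lt_eqF// mul1r.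
  (* c < 0 is impossible: t is so large that a + t^2 c < 0, and the two signs *)
  (* of t cancel the linear term *)
  have := q t; have := q (- t) => h1 h2.
  have : 0 <= a + t ^+ 2 * c by lra.
  rewrite expr2 -mulrA tc; nra.
- have := q (- b / c).
  have -> : a + 2 * (- b / c) * b + (- b / c) ^+ 2 * c = a - b ^+ 2 / c.
    by field; rewrite gt_eqF.
  by rewrite subr_ge0 ler_pdivrMr.
- subst c; rewrite mulr0.
  have [->|b0] := eqVneq b 0; first by rewrite expr0n.
  have := q (- (a + 1) / (2 * b)).
  have -> : a + 2 * (- (a + 1) / (2 * b)) * b
    + (- (a + 1) / (2 * b)) ^+ 2 * 0 = -1 by field.
  by lra.
Qed.

Lemma inner_CS x y : '<x, y> ^+ 2 <= '<x, x> * '<y, y>.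
Proof.
apply: quadratic_ge0 => t; have := inner_ge0 (x + t *: y).
rewrite !innerE (innerC y x); lra.
Qed.

Lemma inner_ext x y : (forall z, '<x, z> = '<y, z>) -> x = y.
Proof.
move=> xy; apply/eqP; rewrite -subr_eq0; apply/eqP/inner_eq0.
by rewrite innerDl innerNl xy subrr.
Qed.

Lemma hnormE x : hnorm x ^+ 2 = '<x, x>.
Proof. by rewrite sqr_sqrtr// inner_ge0. Qed.

Lemma hnorm_ge0 x : 0 <= hnorm x.
Proof. exact: sqrtr_ge0. Qed.

Lemma hnorm_le x y : (hnorm x <= hnorm y) = ('<x, x> <= '<y, y>).
Proof. by rewrite ler_sqrt// inner_ge0. Qed.

End inner_product.

Section riesz.
Context (R : realType) (H : innerProductType R).

(** Completeness, tested on sequences with a prescribed geometric rate. Every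
    Cauchy sequence has such a subsequence; the rate is the one that the
    minimizing sequence and the almost everywhere convergence argument want. *)
Definition rapidly_complete := forall u : nat -> H,
  (forall k l, (k <= l)%N -> '<u k - u l, u k - u l> <= 16^-1 ^+ k) ->
  exists x, forall k, '<u k - x, u k - x> <= 16^-1 ^+ k.

(** The representing vector minimizes J(x) = |x|^2 - 2 f(x): the parallelogram
    identity makes minimizing sequences Cauchy, and the first variation of J
    vanishes at the minimum. *)
Lemma riesz_representation (f : H -> R) (C : R) : rapidly_complete -> 0 <= C ->
  (forall a x y, f (a *: x + y) = a * f x + f y) ->
  (forall x, f x ^+ 2 <= C * '<x, x>) ->
  exists y, forall z, '<y, z> = f z.
Proof.
move=> Hc C0 fl fC.
pose J x := '<x, x> - 2 * f x.
have f0 : f 0 = 0 by have := fl 1 0 0; rewrite scaler0 addr0; lra.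
have fZ a x : f (a *: x) = a * f x by rewrite -[a *: x]addr0 fl f0 addr0.
have fD x y : f (x + y) = f x + f y by rewrite -[x]scale1r fl mul1r scale1r.
have J_lb x : - C <= J x.
  rewrite /J; have := fC x; have := inner_ge0 x.
  set n := '<x, x>; set v := f x => n0 vC.
  have [n_gt0|nle0] := ltP 0 n; last first.
    have nz : n = 0 by apply/le_anti; rewrite nle0.
    have : v = 0.
      by apply/eqP; rewrite -sqrf_eq0 eq_le sqr_ge0 andbT -[leRHS](mulr0 C) -nz.
    by lra.
  rewrite -subr_ge0 -(pmulr_rge0 _ n_gt0).
  by have := sqr_ge0 (n - v); lra.
pose m := inf [set J x | x in setT].
have m_lb x : m <= J x.
  apply: ge_inf; last by exists x.
  by exists (- C) => _ [z _ <-].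
have near_min k : exists z, J z < m + 16^-1 ^+ k / 4.
  have : has_inf [set J x | x in [set: H]].
    by split; [exists (J 0), 0|exists (- C) => _ [z _ <-]].
  move=> /inf_adherent - /(_ (16^-1 ^+ k / 4)) [|_ [z _ <-] zm].
    by rewrite divr_gt0// exprn_gt0// invr_gt0.
  by exists z.
have [u uP] := choice near_min.
have p16 k : 0 < 16^-1 ^+ k :> R by rewrite exprn_gt0// invr_gt0.
have ucauchy k l : (k <= l)%N -> '<u k - u l, u k - u l> <= 16^-1 ^+ k.
  move=> kl.
  have plk : 16^-1 ^+ l <= 16^-1 ^+ k :> R by rewrite ler_wiXn2l//; lra.
  have := m_lb (2^-1 *: (u k + u l)); have := uP k; have := uP l.
  rewrite /J fZ fD !innerE (innerC (u l) (u k)); lra.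
have [x xP] := Hc _ ucauchy.
exists x => z; apply/eqP; rewrite -subr_eq0 -sqrf_eq0 eq_le sqr_ge0 andbT.
(* '<u k, z> - f z is small because u k almost minimizes J along u k + t z, *)
(* and '<u k - x, z> because u k is close to x *)
have bound k : ('<x, z> - f z) ^+ 2 <= 4 * '<z, z> * 16^-1 ^+ k.
  have h1 : ('<u k, z> - f z) ^+ 2 <= 16^-1 ^+ k * '<z, z>.
    apply: quadratic_ge0 => t; have := m_lb (u k + t *: z); have := uP k.
    rewrite /J fD fZ !innerE (innerC z (u k)); have := p16 k; lra.
  have h2 : '<u k - x, z> ^+ 2 <= 16^-1 ^+ k * '<z, z>.
    apply: le_trans (inner_CS _ _) _.
    by rewrite ler_wpM2r ?inner_ge0.
  have -> : '<x, z> - f z = ('<u k, z> - f z) - '<u k - x, z>.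
    by rewrite !innerE; lra.
  move: h1 h2; set p := _ - f z; set q := '<_ - _, _>.
  by have := sqr_ge0 (p + q); nra.
have cv : 4 * '<z, z> * 16^-1 ^+ k @[k --> \oo] --> (0 : R).
  rewrite -(mulr0 (4 * '<z, z>)); apply: cvgMl_tmp.
  by apply: cvg_expr; rewrite ger0_norm; lra.
apply: (ler_cvg_to (cvg_cst _) cv).
by near=> k; exact: bound.
Unshelve. all: by end_near.
Qed.

End riesz.

(** * Subtracting a nonnegative symmetric operator from the identity *)

Section symmetric_operator.
Context (R : realType) (H : innerProductType R).
Implicit Types (S : H -> H) (x y : H).

Lemma symmetric_self_adjoint S :
  (forall a x y, S (a *: x + y) = a *: S x + S y) ->
  (forall x y, '<S x, y> = '<x, S y>) -> self_adjoint setT S.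
Proof.
move=> Sl Ss; split; first by split.
  by move=> x e e0; exists x => //; rewrite subrr /hnorm inner0l sqrtr0.
move=> y z; split => [yz|[_ ->] x _]; last exact: Ss.
split=> //; apply: inner_ext => x.
by rewrite innerC -yz// Ss innerC.
Qed.

Context (S : H -> H) (c : R).
Hypothesis S_linear : forall a x y, S (a *: x + y) = a *: S x + S y.
Hypothesis S_sym : forall x y, '<S x, y> = '<x, S y>.
Hypothesis S_ge0 : forall x, 0 <= '<S x, x>.
Hypothesis S_le : forall x, '<S x, x> <= c * '<x, x>.

Let L x := x - S x.

(** Cauchy-Schwarz for the form of S, at x and S x: it gives
    |S x|^4 <= <S x, x> <S (S x), S x> <= <S x, x> . c |S x|^2. *)
Lemma sqr_form_le x : '<S x, S x> <= c * '<S x, x>.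
Proof.
set w := '<S x, S x>.
have w0 : 0 <= w := inner_ge0 _.
have CS : w ^+ 2 <= '<S x, x> * '<S (S x), S x>.
  apply: quadratic_ge0 => t; have := S_ge0 (t *: S x + x).
  rewrite S_linear !innerE (S_sym (S x) x) -/w; lra.
have [w_gt0|wle0] := ltP 0 w.
  have := S_le (S x); rewrite -/w => h.
  by rewrite -(ler_pM2r w_gt0); have := S_ge0 x; nra.
have Sx0 : S x = 0 by apply/inner_eq0/le_anti; rewrite wle0.
by rewrite /w Sx0 !inner0l mulr0.
Qed.

Let L_linear a x y : L (a *: x + y) = a *: L x + L y.
Proof. by rewrite /L S_linear scalerBr opprD addrACA. Qed.

Let L_decrease x : '<L x, L x> <= '<x, x> - (2 - c) * '<S x, x>.
Proof.
rewrite /L !innerE (innerC x (S x)); have := sqr_form_le x; lra.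
Qed.

Lemma id_sub_self_adjoint : self_adjoint setT L.
Proof.
apply: symmetric_self_adjoint => // x y.
by rewrite /L !innerE S_sym.
Qed.

Hypothesis c_lt2 : c < 2.

Lemma id_sub_contraction x : '<L x, L x> <= '<x, x>.
Proof.
have : 0 <= (2 - c) * '<S x, x> by rewrite mulr_ge0// subr_ge0 ltW.
by have := L_decrease x; lra.
Qed.

Lemma id_sub_non_expansive : non_expansive L.
Proof.
split; first by split.
apply: ge_ereal_sup => _ [x /= x1 <-]; rewrite lee_fin.
by apply: le_trans x1; rewrite hnorm_le id_sub_contraction.
Qed.

(** The energies |L^k x|^2 decrease, and each step costs at least
    (2 - c) <S L^k x, L^k x>; so these forms tend to 0, and sqr_form_le
    transfers this to S L^k x = L^k x - L^(k+1) x. *)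
Lemma id_sub_regular_asymptotic : regular_asymptotic L.
Proof.
split; first by split.
move=> x; pose y k := iter k L x.
pose a k := '<y k, y k>.
have aS k : (2 - c) * '<S (y k), y k> <= a k - a k.+1.
  by have := L_decrease (y k); rewrite /a /= -/(y k); lra.
have a_cvg : cvgn a.
  apply: nonincreasing_is_cvgn; last by exists 0 => _ [k _ <-]; exact: inner_ge0.
  by apply/nonincreasing_seqP => k; exact: id_sub_contraction.
have da_cvg : a k - a k.+1 @[k --> \oo] --> (0 : R).
  rewrite -(subrr (limn a)); apply: cvgB => //.
  by rewrite (cvg_shiftS a).
have S0 : '<S (y k), S (y k)> @[k --> \oo] --> (0 : R).
  have [c0|c0] := leP 0 c; last first.
    rewrite (_ : (fun _ => _) = cst 0); first exact: cvg_cst.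
    apply/funext => k /=; apply/le_anti; rewrite inner_ge0 andbT.
    by apply: le_trans (sqr_form_le _) _; rewrite mulr_le0_ge0// ltW.
  apply: (@squeeze_cvgr _ _ _ _ (cst 0) (fun k => c / (2 - c) * (a k - a k.+1))).
  - near=> k; rewrite inner_ge0/=; apply: le_trans (sqr_form_le _) _.
    rewrite -mulrA ler_wpM2l// mulrC ler_pdivlMr ?subr_gt0// mulrC; exact: aS.
  - exact: cvg_cst.
  - by rewrite -(mulr0 (c / (2 - c))); apply: cvgMl_tmp.
rewrite (_ : (fun _ => _) = fun k => Num.sqrt '<S (y k), S (y k)>); last first.
  apply/funext => k /=; rewrite -/(y k) /hnorm /L; congr Num.sqrt.
  by rewrite addrAC subrr add0r innerNl innerNr opprK.
by rewrite -sqrtr0; apply: (cvg_comp _ _ S0); exact: sqrt_continuous.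
Unshelve. all: by end_near.
Qed.

End symmetric_operator.

(** * Completeness of L^2 *)

Section riesz_fischer.
Context d (T : measurableType d) (R : realType).
Variable mu : {measure set T -> \bar R}.

Lemma measurable_L2_fun (F : L2 mu) : measurable_fun setT (L2_fun F).
Proof. by have := L2_funP F; rewrite inE => /andP[]; rewrite inE. Qed.

Lemma L2_subE (F G : L2 mu) :
  \forall x \ae mu, L2_fun (F - G) x = L2_fun F x - L2_fun G x.
Proof.
rewrite -scaleN1r.
apply: filterS2 (L2_addE F (-1 *: G)) (L2_scalE (-1) G) => x aE sE.
by rewrite (aE I)/= (sE I)/= mulN1r.
Qed.

Lemma L2_inner_integral (F : L2 mu) :
  ('<F, F>%:E = \int[mu]_x (L2_fun F x ^+ 2)%:E)%E.
Proof.
have -> : '<F, F> = L2_inner F F by reflexivity.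
rewrite /L2_inner /Rintegral fineK.
  by apply: eq_integral.
exact/integrable_fin_num/(Lfun2_integrable_sqr (L2_funP F)).
Qed.

Lemma L2_dist_integral (F : L2 mu) (g : T -> R) : measurable_fun setT g ->
  (\forall x \ae mu, L2_fun F x = g x) ->
  ('<F, F>%:E = \int[mu]_x (g x ^+ 2)%:E)%E.
Proof.
move=> mg Fg; rewrite L2_inner_integral.
apply: ge0_ae_eq_integral => //.
- exact/measurable_EFinP/measurable_funX/measurable_L2_fun.
- exact/measurable_EFinP/measurable_funX.
- by move=> x _; rewrite lee_fin sqr_ge0.
- by move=> x _; rewrite lee_fin sqr_ge0.
- by apply: filterS Fg => x /= -> _.
Qed.

Lemma Lfun2_of_integral (g : T -> R) : measurable_fun setT g ->
  (\int[mu]_x (g x ^+ 2)%:E < +oo)%E -> g \in Lfun mu 2%:R%:E.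
Proof.
move=> mg gfin; rewrite inE; apply/andP; split; rewrite inE//=.
rewrite /finite_norm unlock; apply: poweR_lty.
rewrite (eq_integral (fun x => (g x ^+ 2)%:E))// => x _ /=.
by rewrite powR_mulrn// real_normK ?num_real.
Qed.

(** The weighted series of 4^k (f_(k+1) - f_k)^2 has a finite integral, so it is
    finite almost everywhere; where its sum is c, the increments are bounded by
    the summable sequence sqrt(c) 2^-k. *)
Lemma ae_cvg_of_rapid (f : nat -> T -> R) :
  (forall k, measurable_fun setT (f k)) ->
  (forall k, (\int[mu]_x ((f k.+1 x - f k x) ^+ 2)%:E <= (16^-1 ^+ k)%:E)%E) ->
  \forall x \ae mu, cvgn (f^~ x).
Proof.
move=> mf fle.
pose D k x := (4 ^+ k * (f k.+1 x - f k x) ^+ 2)%:E : \bar R.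
pose h x := (\big[+%E/0%R]_(0 <= k <oo) D k x)%E.
have D0 k x : (0 <= D k x)%E.
  by rewrite lee_fin; apply: mulr_ge0; [exact: exprn_ge0|exact: sqr_ge0].
have mD k : measurable_fun setT (D k).
  apply/measurable_EFinP/measurable_funM => //.
  by apply/measurable_funX; apply: measurable_funB.
have mh : measurable_fun setT h by apply: ge0_emeasurable_sum.
have hlt : (\int[mu]_x h x < +oo)%E.
  rewrite integral_nneseries//.
  have geo := @cvg_geometric_eseries_half R 2 0.
  apply: (@le_lt_trans _ _ (2 / 2 ^+ 0)%:E); last exact: ltry.
  rewrite -(cvg_lim _ geo)//; apply: lee_nneseries.
    by move=> k _ _; apply: integral_ge0.
  move=> k _; under eq_integral do rewrite /D EFinM.
  rewrite ge0_integralZl_EFin//; last first.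
    exact/measurable_EFinP/measurable_funX/measurable_funB.
    by move=> x _; rewrite lee_fin sqr_ge0.
  apply: (@le_trans _ _ ((4 ^+ k)%:E * (16^-1 ^+ k)%:E)%E).
    by rewrite lee_wpmul2l// lee_fin exprn_ge0.
  rewrite -EFinM lee_fin -exprMn addn1 natrX exprS invfM mulrA divff// mul1r.
  rewrite -exprVn.
  by rewrite lerXn2r ?nnegrE//; lra.
have ih : mu.-integrable setT h.
  apply/integrableP; split => //.
  by under eq_integral do rewrite gee0_abs ?nneseries_ge0//.
apply: filterS (integrable_ae measurableT ih) => x /(_ I) hx.
pose c := fine (h x).
have dle k : `|f k.+1 x - f k x| <= Num.sqrt c * 2^-1 ^+ k.
  have : (D k x <= c%:E)%E.
    rewrite fineK//; apply: le_trans (nneseries_lim_ge k.+1 _) => //.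
    by rewrite big_nat_recr//= leeDr// sume_ge0.
  rewrite lee_fin => Dc.
  have c0 : 0 <= c by apply: le_trans Dc; have := D0 k x; rewrite lee_fin.
  rewrite -sqrtr_sqr -(@ler_pXn2r _ 2)// ?nnegrE ?sqrtr_ge0 ?mulr_ge0 ?sqrtr_ge0 ?exprn_ge0//.
  rewrite sqr_sqrtr ?sqr_ge0// exprMn sqr_sqrtr// -exprM mulnC exprM exprVn -exprVn.
  rewrite -ler_pdivrMr ?exprn_gt0 ?exprn_gt0 ?invr_gt0// -exprVn mulrC.
  by rewrite (_ : (2^-1 ^+ 2)^-1 = 4 :> R)//; field.
have : cvgn [normed series (telescope (f^~ x))].
  apply: (@series_le_cvg _ _ (geometric (Num.sqrt c) 2^-1)).
  - by move=> k; rewrite /= normr_ge0.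
  - by move=> k; apply: geometric_ge0; rewrite ?sqrtr_ge0 ?invr_ge0.
  - exact: dle.
  - by apply: is_cvg_geometric_series; rewrite ger0_norm; lra.
move=> /(@normed_cvg R R^o); rewrite telescopeK => cv.
have -> : f^~ x = (fun n => f 0 x + (f n x - f 0 x)).
  by apply/funext => n; rewrite addrC subrK.
by apply: is_cvgD => //; exact: is_cvg_cst.
Qed.

(** A bound on the L^2 distance from h passes to almost everywhere limits, by
    Fatou. *)
Lemma fatou_sqr_dist (f : nat -> T -> R) (g : T -> R) (h : T -> R) (c : R) :
  (forall k, measurable_fun setT (f k)) -> measurable_fun setT g ->
  measurable_fun setT h ->
  (\forall x \ae mu, f^~ x @ \oo --> g x) ->
  (forall k, (\int[mu]_x ((h x - f k x) ^+ 2)%:E <= c%:E)%E) ->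
  (\int[mu]_x ((h x - g x) ^+ 2)%:E <= c%:E)%E.
Proof.
move=> mf mg mh fg fle.
pose v k x := ((h x - f k x) ^+ 2)%:E : \bar R.
have v0 k x : (0 <= v k x)%E by rewrite lee_fin sqr_ge0.
have mv k : measurable_fun setT (v k).
  exact/measurable_EFinP/measurable_funX/measurable_funB.
have le_einf (w : nat -> \bar R) (b : \bar R) :
    (forall k, w k <= b)%E -> (limn_einf w <= b)%E.
  move=> wb; rewrite limn_einf_lim; apply: lime_le; first exact: is_cvg_einfs.
  apply: nearW => k; apply: le_trans (wb k); apply: ereal_inf_lbound.
  by exists k => /=.
have ge_einf (w : nat -> \bar R) :
    (forall k, 0 <= w k)%E -> (0 <= limn_einf w)%E.
  move=> wb; rewrite limn_einf_lim; apply: lime_ge; first exact: is_cvg_einfs.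
  by apply: nearW => k; apply: le_ereal_inf_tmp => _ [n _ <-].
rewrite (@ge0_ae_eq_integral _ _ _ mu _ _ (fun x => limn_einf (v^~ x)))//.
- by apply: le_trans (fatou mu measurableT mv _) _ => //; exact: le_einf.
- exact/measurable_EFinP/measurable_funX/measurable_funB.
- rewrite (_ : (fun _ => _) = (fun x => - limn_esup (fun k => - v k x)))%E.
    apply/measurableT_comp => //; apply: measurable_fun_limn_esup => k.
    exact: measurableT_comp.
  by [].
- by move=> x _; rewrite lee_fin sqr_ge0.
- by move=> x _; exact: ge_einf.
apply: filterS fg => x fx _ /=; apply/esym.
have vx : v k x @[k --> \oo] --> ((h x - g x) ^+ 2)%:E.
  apply: cvg_EFin; first exact: nearW.
  rewrite /comp /= expr2; under eq_fun do rewrite expr2.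
  by apply: cvgM; apply: cvgB => //; exact: cvg_cst.
by rewrite (cvg_limn_einf_sup vx).1.
Qed.

(** The Riesz-Fischer theorem: the limit in norm is the almost everywhere
    limit. *)
Lemma L2_rapidly_complete : rapidly_complete (L2 mu).
Proof.
move=> u uP; pose f k := L2_fun (u k).
have mf k : measurable_fun setT (f k) := measurable_L2_fun _.
have fle k l : (k <= l)%N ->
    (\int[mu]_x ((f k x - f l x) ^+ 2)%:E <= (16^-1 ^+ k)%:E)%E.
  move=> kl; rewrite -(@L2_dist_integral (u k - u l)) ?lee_fin ?uP//.
    exact: measurable_funB.
  exact: L2_subE.
have fcv : \forall x \ae mu, cvgn (f^~ x).
  apply: ae_cvg_of_rapid => // k; apply: le_trans (fle k k.+1 (leqnSn k)).
  by under eq_integral do rewrite -sqrrN opprB.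
(* the upper limit is the limit where it exists, and is measurable everywhere *)
pose g x := fine (limn_esup (fun k => (f k x)%:E)).
have mg : measurable_fun setT g.
  apply: measurableT_comp => //; apply: measurable_fun_limn_esup => k.
  exact/measurable_EFinP.
have fg : \forall x \ae mu, f^~ x @ \oo --> g x.
  apply: filterS fcv => x fx.
  have fx' : (f k x)%:E @[k --> \oo] --> (limn (f^~ x))%:E.
    by apply: cvg_EFin => //; exact: nearW.
  by rewrite /g (cvg_limn_einf_sup fx').2.
have gle k : (\int[mu]_x ((f k x - g x) ^+ 2)%:E <= (16^-1 ^+ k)%:E)%E.
  apply: (@fatou_sqr_dist (fun n => f (n + k)%N)) => //.
    by apply: filterS fg => x; rewrite -(cvg_shiftn k).
  by move=> n; apply: fle; rewrite leq_addl.
have fgL : (fun x => f 0 x - g x) \in Lfun mu 2%:R%:E.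
  apply: Lfun2_of_integral; first exact: measurable_funB.
  exact: le_lt_trans (gle 0) (ltry _).
have gL : g \in Lfun mu 2%:R%:E.
  have [_] := @Lfun_submod_closed _ _ _ mu _ (lee1n 2).
  move=> /(_ (-1) _ _ fgL (L2_funP (u 0))).
  rewrite (_ : _ + _ = g)//; apply/funext => x.
  have -> : (-1 *: (fun x => f 0 x - g x) + L2_fun (u 0)) x =
    -1 * (f 0 x - g x) + f 0 x by [].
  by ring.
exists (L2_of gL) => k.
rewrite -lee_fin (@L2_dist_integral _ (fun x => f k x - g x))//.
  exact: measurable_funB.
apply: filterS2 (L2_subE (u k) (L2_of gL)) (L2_ofE gL) => x -> /= gx.
by rewrite (gx I).
Qed.

End riesz_fischer.

(** * Integration over finite measures *)

Section off_null.
Context d (T : measurableType d) (R : realType).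
Variables (mu : {measure set T -> \bar R}) (m : R).
Hypothesis mu_m : mu setT = m%:E.
Implicit Types (f : T -> R) (N : set T).

Let integrable_cst (k : R) : mu.-integrable setT (cst k%:E).
Proof.
apply/integrableP; split => //.
by under eq_integral do rewrite /=; rewrite integral_cst// mu_m -EFinM ltry.
Qed.

Lemma integrable_off_null f N (K : R) : measurable_fun setT f ->
  measurable N -> mu N = 0%E -> (forall s, ~ N s -> `|f s| <= K) ->
  mu.-integrable setT (EFin \o f).
Proof.
move=> mf mN N0 fK; apply/integrableP; split; first exact/measurable_EFinP.
have mTN : measurable (setT `\` N) by exact: measurableD.
rewrite (@ge0_negligible_integral _ _ _ _ _ N)//; last first.
  by apply: measurableT_comp => //; exact/measurable_EFinP.
apply: (@le_lt_trans _ _ (\int[mu]_(x in setT `\` N) K%:E)%E).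
  apply: ge0_le_integral => //.
  - apply: measurable_funTS; apply: measurableT_comp => //; exact/measurable_EFinP.
  - by move=> s [_ Ns]; rewrite lee_fin; exact: fK.
have /integrable_fin_num : mu.-integrable (setT `\` N) (cst K%:E).
  exact: (integrableS measurableT).
by move=> /(_ mTN); rewrite fin_numElt => /andP[].
Qed.

Lemma Rintegral_le_off_null f N (b : R) : mu.-integrable setT (EFin \o f) ->
  measurable N -> mu N = 0%E -> (forall s, ~ N s -> f s <= b) ->
  \int[mu]_s f s <= b * m.
Proof.
move=> intf mN N0 fb.
have mTN : measurable (setT `\` N) by exact: measurableD.
have -> : b * m = \int[mu]_s b by rewrite Rintegral_cst// mu_m.
rewrite /Rintegral (negligible_integral mN measurableT intf N0).
rewrite [X in _ <= fine X](negligible_integral mN measurableT (integrable_cst b) N0).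
apply: le_Rintegral => //.
- exact: (integrableS measurableT _ _ intf).
- exact: (integrableS measurableT _ _ (integrable_cst b)).
- by move=> s [_]; exact: fb.
Qed.

Lemma Rintegral_ge_off_null f N (b : R) : mu.-integrable setT (EFin \o f) ->
  measurable N -> mu N = 0%E -> (forall s, ~ N s -> b <= f s) ->
  b * m <= \int[mu]_s f s.
Proof.
move=> intf mN N0 fb.
have mTN : measurable (setT `\` N) by exact: measurableD.
have -> : b * m = \int[mu]_s b by rewrite Rintegral_cst// mu_m.
rewrite /Rintegral (negligible_integral mN measurableT intf N0).
rewrite [X in fine X <= _](negligible_integral mN measurableT (integrable_cst b) N0).
apply: le_Rintegral => //.
- exact: (integrableS measurableT _ _ (integrable_cst b)).
- exact: (integrableS measurableT _ _ intf).
- by move=> s [_]; exact: fb.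
Qed.

End off_null.

Section measure_identity.
Context d (T : measurableType d) (R : realType).

(** The linearity of a polarized integral is an identity between six measures.
    Moving the negative terms to the other side avoids signed measures. *)
Lemma eq_integral_measure_comb (m1 m2 m3 n1 n2 n3 : {measure set T -> \bar R})
    (a : {nonneg R}) (f : T -> \bar R) :
  measurable_fun setT f -> (forall s, 0 <= f s)%E ->
  (forall B, measurable B ->
    m1 B + a%:num%:E * m2 B + m3 B = n1 B + a%:num%:E * n2 B + n3 B)%E ->
  (\int[m1]_s f s + a%:num%:E * \int[m2]_s f s + \int[m3]_s f s =
   \int[n1]_s f s + a%:num%:E * \int[n2]_s f s + \int[n3]_s f s)%E.
Proof.
move=> mf f0 mn.
have comb (p1 p2 p3 : {measure set T -> \bar R}) :
  (\int[measure_add (measure_add p1 (mscale a p2)) p3]_s f s =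
   \int[p1]_s f s + a%:num%:E * \int[p2]_s f s + \int[p3]_s f s)%E.
  by rewrite !ge0_integral_measure_add// ge0_integral_mscale.
rewrite -!comb; apply: eq_measure_integral => B mB _.
have combB (p1 p2 p3 : {measure set T -> \bar R}) :
  (measure_add (measure_add p1 (mscale a p2)) p3 B =
   p1 B + a%:num%:E * p2 B + p3 B)%E.
  by rewrite measure_addE; congr (_ + _)%E; exact: measure_addE.
by apply: etrans (combB _ _ _) (etrans _ (esym (combB _ _ _))); exact: mn.
Qed.

End measure_identity.

(** * The quadratic form of a function of the operator *)

Section spectral.
Context (R : realType) (H : innerProductType R).
Variable E : resolution_of_identity H.
Implicit Types (x y z : H) (B : set (measurableTypeR R)) (f : R -> R).

Lemma pvm_linear B a x y : measurable B ->
  E B (a *: x + y) = a *: E B x + E B y.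
Proof. by move=> /(pvm_self_adjoint E)[[_ lin] _ _]; have [] := lin a x y. Qed.

Lemma pvmD B x y : measurable B -> E B (x + y) = E B x + E B y.
Proof. by move=> mB; have := pvm_linear 1 x y mB; rewrite !scale1r. Qed.

Lemma pvm_at0 B : measurable B -> E B 0 = 0.
Proof. by move=> mB; apply: (addIr (E B 0)); rewrite -pvmD// addr0 add0r. Qed.

Lemma pvmZ B a x : measurable B -> E B (a *: x) = a *: E B x.
Proof.
by move=> mB; have := pvm_linear a x 0 mB; rewrite addr0 pvm_at0// addr0.
Qed.

Lemma pvmN B x : measurable B -> E B (- x) = - E B x.
Proof. by move=> mB; rewrite -scaleN1r pvmZ// scaleN1r. Qed.

Lemma spectral_measureT x : spectral_measure E x setT = '<x, x>%:E.
Proof. by rewrite /spectral_measure !pvmT. Qed.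

Lemma spectral_measure_eq0 B x : E B x = 0 -> spectral_measure E x B = 0%E.
Proof. by rewrite /spectral_measure => ->; rewrite inner0l. Qed.

Lemma spectral_measure_eq0P B x : spectral_measure E x B = 0%E -> E B x = 0.
Proof. by move=> [] /inner_eq0. Qed.

(** Polarization at z = x leaves the measure of 2 x, four times that of x. It
    is kept in this form so that no integral of a signed function has to be
    rescaled. *)
Lemma spectral_form_diag f x :
  spectral_form E f x x = (\int[spectral_measure E (x + x)]_s f s) / 4.
Proof.
rewrite /spectral_form subrr.
have -> : \int[spectral_measure E 0]_s f s = 0.
  rewrite /Rintegral (eq_measure_integral mzero) ?integral_measure_zero//.
  by move=> B mB _; rewrite /= spectral_measure_eq0// pvm_at0.
by rewrite subr0.
Qed.

Let inner_double x : '<x + x, x + x> = 4 * '<x, x>.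
Proof. by rewrite !innerE; ring. Qed.

Let pvm_double N x : measurable N -> E N x = 0 ->
  spectral_measure E (x + x) N = 0%E.
Proof. by move=> mN Nx; apply: spectral_measure_eq0; rewrite pvmD// Nx addr0. Qed.

Lemma spectral_form_le f x N (b : R) :
  (spectral_measure E (x + x)).-integrable setT (EFin \o f) ->
  measurable N -> E N x = 0 -> (forall s, ~ N s -> f s <= b) ->
  spectral_form E f x x <= b * '<x, x>.
Proof.
move=> intf mN Nx fb; rewrite spectral_form_diag ler_pdivrMr//.
apply: le_trans (Rintegral_le_off_null (spectral_measureT _) intf mN _ fb) _.
  exact: pvm_double.
by rewrite inner_double; lra.
Qed.

Lemma spectral_form_ge f x N (b : R) :
  (spectral_measure E (x + x)).-integrable setT (EFin \o f) ->
  measurable N -> E N x = 0 -> (forall s, ~ N s -> b <= f s) ->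
  b * '<x, x> <= spectral_form E f x x.
Proof.
move=> intf mN Nx fb; rewrite spectral_form_diag ler_pdivlMr//.
apply: le_trans _ (Rintegral_ge_off_null (spectral_measureT _) intf mN _ fb).
  by rewrite inner_double; lra.
exact: pvm_double.
Qed.

Section bounded.
Context (g : R -> R) (b : R).
Hypothesis mg : measurable_fun setT g.
Hypothesis g_ge0 : forall s, 0 <= g s.
Hypothesis g_le : forall s, g s <= b.

Lemma bounded_integrable x :
  (spectral_measure E x).-integrable setT (EFin \o g).
Proof.
apply: (integrable_off_null (spectral_measureT x) mg measurable0 (measure0 _)).
by move=> s _; rewrite ger0_norm//; exact: g_le.
Qed.

Local Notation F := (spectral_form E g).
Let q x := \int[spectral_measure E x]_s g s.

Let qE x : (\int[spectral_measure E x]_s (g s)%:E)%E = (q x)%:E.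
Proof. by rewrite fineK//; exact/integrable_fin_num/bounded_integrable. Qed.

Let qN x : q (- x) = q x.
Proof.
rewrite /q /Rintegral (eq_measure_integral (spectral_measure E x))//.
by move=> B mB _; rewrite /= /spectral_measure pvmN// innerNl innerNr opprK.
Qed.

Lemma spectral_formC x z : F x z = F z x.
Proof.
by rewrite /spectral_form -!/(q _) (addrC x) -[z - x]opprB qN.
Qed.

(* Only for 0 <= a can a be absorbed into the measures; the other sign follows *)
(* from the oddness of the form. *)
Let form_pos a x y z : 0 <= a -> F (a *: x + y) z = a * F x z + F y z.
Proof.
move=> a0.
have : q (a *: x + y + z) + a * q (x - z) + q (y - z) =
       q (a *: x + y - z) + a * q (x + z) + q (y + z).
  pose c := NngNum a0.
  apply: EFin_inj; rewrite !EFinD !EFinM -!qE.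
  apply: (@eq_integral_measure_comb _ _ _ _ _ _ _ _ _ c).
  - exact/measurable_EFinP.
  - by move=> s; rewrite lee_fin.
  move=> B mB; rewrite /= /spectral_measure -!EFinM -!EFinD; congr EFin.
  rewrite !(pvmD, pvmZ, pvmN)// !innerE.
  rewrite (innerC (E B z) (E B x)) (innerC (E B z) (E B y)) (innerC (E B y) (E B x)).
  by ring.
by rewrite /spectral_form -!/(q _); lra.
Qed.

Lemma spectral_form_linear a x y z : F (a *: x + y) z = a * F x z + F y z.
Proof.
have [/form_pos//|a_lt0] := leP 0 a.
have N x' : F (- x') z = - F x' z.
  rewrite /spectral_form -!/(q _) -(qN (- x' + z)) -(qN (- x' - z)).
  by rewrite !opprD !opprK; lra.
rewrite -[a]opprK scaleNr -scalerN form_pos ?N ?oppr_ge0 ?ltW//.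
by ring.
Qed.

Lemma spectral_form_psd x : 0 <= F x x.
Proof.
rewrite -[leLHS](mul0r '<x, x>).
by apply: (spectral_form_ge (bounded_integrable _) measurable0); rewrite ?pvm0.
Qed.

Lemma spectral_form_bound x : F x x <= b * '<x, x>.
Proof.
by apply: (spectral_form_le (bounded_integrable _) measurable0); rewrite ?pvm0.
Qed.

Lemma spectral_domT x : spectral_dom E g x.
Proof.
have mg2 : measurable_fun setT (fun s => g s ^+ 2) by exact: measurable_funX.
have : (spectral_measure E x).-integrable setT (EFin \o (fun s => g s ^+ 2)).
  apply: (integrable_off_null (spectral_measureT x) mg2 measurable0 (measure0 _)).
  move=> s _; rewrite ger0_norm ?sqr_ge0//; apply: (_ : _ <= b ^+ 2).
  by rewrite lerXn2r ?nnegrE// (le_trans (g_ge0 s)).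
move=> /integrable_fin_num - /(_ measurableT).
by rewrite fin_numElt => /andP[].
Qed.

Lemma spectral_integralE x z : rapidly_complete H ->
  '<spectral_integral E g x, z> = F x z.
Proof.
move=> Hc.
have [y yP] : exists y, forall z, '<y, z> = F x z.
  have b0 : 0 <= b := le_trans (g_ge0 0) (g_le 0).
  apply: (@riesz_representation _ _ _ (b ^+ 2 * '<x, x>) Hc).
  - by rewrite mulr_ge0 ?sqr_ge0 ?inner_ge0.
  - by move=> a u v; rewrite !(spectral_formC x) spectral_form_linear.
  move=> v; apply: (@le_trans _ _ (F x x * F v v)).
    apply: quadratic_ge0 => t; have := spectral_form_psd (t *: v + x).
    rewrite spectral_form_linear 2!(spectral_formC _ (t *: v + x)).
    by rewrite !spectral_form_linear (spectral_formC v x); lra.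
  have xx0 := inner_ge0 x; have vv0 := inner_ge0 v.
  have -> : b ^+ 2 * '<x, x> * '<v, v> = (b * '<x, x>) * (b * '<v, v>) by ring.
  by rewrite ler_pM ?spectral_form_psd ?spectral_form_bound.
have : spectral_graph E g x (spectral_integral E g x).
  by apply: (@xgetPex _ 0 [set y | spectral_graph E g x y]); exists y.
by apply; exact: spectral_domT.
Qed.

End bounded.

End spectral.

Section strict.
Context (R : realType) (H : innerProductType R) (E : resolution_of_identity H).

Lemma spectral_form_eq0 (g : R -> R) (b : R) x : measurable_fun setT g ->
  (forall s, 0 < g s) -> (forall s, g s <= b) ->
  spectral_form E g x x = 0 -> x = 0.
Proof.
move=> mg g_gt0 g_le; rewrite spectral_form_diag => /eqP.
rewrite mulf_eq0 invr_eq0 (negbTE (_ : 4 != 0)) ?pnatr_eq0// orbF => /eqP int0.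
set mu := spectral_measure E (x + x) in int0.
have g_ge0 s : 0 <= g s := ltW (g_gt0 s).
have : (\int[mu]_s `|(g s)%:E| = 0)%E.
  rewrite -[RHS]/(0 : R)%:E -int0 fineK.
    by apply: eq_integral => s _; rewrite gee0_abs// lee_fin.
  exact/integrable_fin_num/(bounded_integrable E mg g_ge0 g_le).
move/(ae_eq_integral_abs mu measurableT).
move=> /(_ (proj2 (measurable_EFinP _ _) mg)) [N [mN N0 subN]].
have muT : mu setT = 0%E.
  apply: (subset_measure0 _ mN _ N0) => // s _; apply: subN => /= /(_ I) [].
  by move=> /eqP; rewrite gt_eqF.
have /inner_eq0 : '<x + x, x + x> = 0.
  by apply: EFin_inj; rewrite -(spectral_measureT E) -/mu muT.
by move=> /eqP; rewrite -mulr2n -scaler_nat scaler_eq0 pnatr_eq0 => /eqP.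
Qed.

End strict.

(** * The bottom of the spectrum *)

Section bottom_of_spectrum.
Context (R : realType) (H : innerProductType R).
Variable E : resolution_of_identity H.
Implicit Types (x y z : H) (B : set (measurableTypeR R)).

Let m_below (a : R) : measurable (`]-oo, a[ : set (measurableTypeR R)).
Proof. exact: measurable_itv. Qed.

Lemma pvm_subset_eq0 B C x : measurable B -> measurable C -> B `<=` C ->
  (forall y, E C y = 0) -> E B x = 0.
Proof. by move=> mB mC /setIidl <- C0; rewrite pvmI// C0 pvm_at0. Qed.

Lemma pvm_bigcup_eq0 (F : nat -> set (measurableTypeR R)) x :
  (forall k, measurable (F k)) -> (forall k, E (F k) x = 0) ->
  E (\bigcup_k F k) x = 0.
Proof.
move=> mF F0; apply: spectral_measure_eq0P; apply/le_anti/andP; split => //.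
apply: le_trans (measure_sigma_subadditive (spectral_measure E x) mF _ _) _ => //.
  exact: bigcupT_measurable.
by rewrite eseries0// => k _ _; exact: spectral_measure_eq0.
Qed.

Lemma pvm_off_range B x : measurable B -> E (~` B) (E B x) = 0.
Proof. by move=> mB; rewrite -pvmI ?setICl ?pvm0//; exact: measurableC. Qed.

Lemma spectral_dom_bounded B (K : R) x : measurable B ->
  (forall s, B s -> `|s| <= K) -> spectral_dom E id (E B x).
Proof.
move=> mB BK.
have : (spectral_measure E (E B x)).-integrable setT (EFin \o (fun s => s ^+ 2)).
  apply: (integrable_off_null (K := K ^+ 2) (spectral_measureT E _) _ (measurableC mB)).
  - exact: measurable_funX.
  - exact/spectral_measure_eq0/pvm_off_range.
  move=> s /contrapT /BK sK.
  by rewrite normrX lerXn2r ?nnegrE// (le_trans _ sK).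
move=> /integrable_fin_num - /(_ measurableT).
by rewrite fin_numElt => /andP[].
Qed.

Lemma integrable_id x : spectral_dom E id x ->
  (spectral_measure E x).-integrable setT (EFin \o id).
Proof.
move=> xdom.
have i1 : (spectral_measure E x).-integrable setT (EFin \o cst 1).
  apply: (integrable_off_null (K := 1) (spectral_measureT E _) _ measurable0) => //.
  by move=> s _; rewrite normr1.
have i2 : (spectral_measure E x).-integrable setT (fun s => (s ^+ 2)%:E).
  apply/integrableP; split; first exact/measurable_EFinP/measurable_funX.
  by under eq_integral do rewrite gee0_abs ?lee_fin ?sqr_ge0//.
apply: (le_integrable measurableT _ _ (integrableD measurableT i1 i2)) => //.
  exact/measurable_EFinP.
move=> s _ /=; rewrite lee_fin (ger0_norm (_ : 0 <= 1 + s ^+ 2)).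
  rewrite ler_norml; have := sqr_ge0 s.
  by have := sqr_ge0 (s - 1); have := sqr_ge0 (s + 1); lra.
by rewrite addr_ge0 ?sqr_ge0.
Qed.

Variables (D : set H) (A : H -> H).
Hypothesis A_sa : self_adjoint D A.
Hypothesis E_A : resolution_of D A E.

Let D_lin a x y : D x -> D y ->
  D (a *: x + y) /\ A (a *: x + y) = a *: A x + A y.
Proof. by have [[_ lin] _ _] := A_sa => /lin; apply. Qed.

Let A_sym x y : D x -> D y -> '<A x, y> = '<x, A y>.
Proof. by have [_ _ adj] := A_sa => Dx Dy; exact: (adj y (A y)).2. Qed.

Let D_dom x : D x -> spectral_dom E id x.
Proof. by have [-> _] := E_A. Qed.

Let A_form x : D x -> '<A x, x> = spectral_form E id x x.
Proof. by have [_ /(_ x)] := E_A => gr Dx; exact/gr/D_dom. Qed.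

Let int_id x : D x -> (spectral_measure E (x + x)).-integrable setT (EFin \o id).
Proof.
move=> Dx; apply/integrable_id/D_dom.
by have [] := D_lin 1 Dx Dx; rewrite scale1r.
Qed.

Let D_range B (K : R) x : measurable B -> (forall s, B s -> `|s| <= K) ->
  D (E B x).
Proof. by have [-> _] := E_A; exact: spectral_dom_bounded. Qed.

(** On the range of E([- k, 0[), which lies in the domain, the form of A is
    nonpositive, so positivity of A makes this range trivial. *)
Lemma pvm_negative_eq0 x : positive_operator D A -> E `]-oo, 0[%classic x = 0.
Proof.
move=> A_pos.
have -> : `]-oo, 0[%classic = \bigcup_k (`]- k%:R, 0[%classic : set R).
  apply/seteqP; split => [s|s [k _]] /=; rewrite !in_itv/=; last by case/andP.
  move=> s0; exists (Num.truncn (- s)).+1 => //=; rewrite in_itv/= s0 andbT ltrNl.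
  exact: truncnS_gt.
apply: pvm_bigcup_eq0 => k; first exact: measurable_itv.
set B := `]_, _[%classic; set y := E B x.
have mB : measurable (B : set (measurableTypeR R)) by exact: measurable_itv.
have Dy : D y.
  apply: (@D_range _ k%:R) => // s; rewrite /B /= in_itv/= => /andP[ks s0].
  by rewrite ltr0_norm// lerNl ltW.
apply/eqP/negP => /negP y0; have := A_pos _ Dy y0.
rewrite ltNge A_form// -[leRHS](mul0r '<y, y>) => /negP; apply.
apply: (spectral_form_le (int_id Dy) (measurableC mB)).
  exact: pvm_off_range.
by move=> s /contrapT; rewrite /B /= in_itv/= => /andP[_ /ltW].
Qed.

(** A point of the resolvent set that bounds the spectral support from below is
    at a positive distance from it. The nonnegative form P(u, v) = <(A - M) u, v>
    is at most e |y|^2 at a vector y of the range of E([M, M + e[), while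
    P(y, z) = |y|^2 for z = (A - M)^-1 y; these are incompatible with
    Cauchy-Schwarz as soon as e times the norm of the resolvent is below 1. *)
Lemma pvm_gap (M : R) : 0 <= M -> (forall x, E `]-oo, M[%classic x = 0) ->
  resolvent_set D A M -> exists2 e, 0 < e & forall x, E `]-oo, M + e[%classic x = 0.
Proof.
move=> M0 EM [S [SA _ [C SC]]].
(* C may be 0 or negative when H is trivial *)
pose C' := `|C| + 1.
have C'0 : 0 < C' by rewrite ltr_wpDl.
pose e := (2 * C')^-1.
have e0 : 0 < e by rewrite invr_gt0 mulr_gt0.
exists e => // x.
pose B : set (measurableTypeR R) := `[M, M + e[%classic.
have mB : measurable B by exact: measurable_itv.
suff EB0 : E B x = 0.
  have -> : `]-oo, M + e[%classic =
      \bigcup_k (if k is 0%N then B else `]-oo, M[%classic).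
    apply/seteqP; split => [s|s [[|k] _]]; rewrite /B /= !in_itv/=.
    - move=> sMe; have [sM|Ms] := ltP s M.
        by exists 1%N => //=; rewrite in_itv.
      by exists 0%N => //=; rewrite in_itv/= Ms sMe.
    - by move=> /andP[].
    - by move=> sM; rewrite (lt_trans sM)// ltrDl.
  by apply: pvm_bigcup_eq0 => -[|k]; rewrite ?EM//; exact: measurable_itv.
set y := E B x.
have Dy : D y.
  apply: (@D_range _ (M + e)) => // s; rewrite /B /= in_itv/= => /andP[Ms sM].
  by rewrite (ger0_norm (le_trans M0 Ms)) ltW.
set z := S y.
have [Dz Az] := SA y; rewrite -/z in Dz Az.
have {}Az : A z = y + M *: z by rewrite -Az subrK.
have ge u : D u -> M * '<u, u> <= '<A u, u>.
  move=> Du; rewrite A_form//.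
  apply: (spectral_form_ge (int_id Du) (m_below M) (EM u)) => s /=.
  by rewrite in_itv/= => /negP; rewrite -leNgt.
have le : '<A y, y> <= (M + e) * '<y, y>.
  rewrite A_form//; apply: (spectral_form_le (int_id Dy) (measurableC mB)).
    exact: pvm_off_range.
  by move=> s /contrapT; rewrite /B /= in_itv/= => /andP[_ /ltW].
have yAz : '<A y, z> = '<y, y> + M * '<y, z>.
  by rewrite A_sym// Az !innerE.
set a := '<A y, y> - M * '<y, y>.
set b := '<y, y>; set c := '<y, z>.
(* a = P(y, y), b = P(y, z) and c = P(z, z) *)
have b2 : b ^+ 2 <= a * c.
  apply: quadratic_ge0 => t.
  have [Du Au] := D_lin t Dz Dy.
  have := ge _ Du; rewrite Au Az !innerE (innerC z y) yAz /a -/b -/c.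
  by lra.
have c_le : c <= C' * b.
  have b0 : 0 <= b := inner_ge0 y.
  have zz : '<z, z> <= C' ^+ 2 * b.
    rewrite /b -!hnormE -exprMn ler_sqr ?nnegrE ?mulr_ge0 ?hnorm_ge0 ?(ltW C'0)//.
    apply: le_trans (SC y I) _; rewrite ler_wpM2r ?hnorm_ge0// /C'.
    by rewrite (le_trans (ler_norm _))// lerDl.
  have Cb0 : 0 <= C' * b by rewrite mulr_ge0// ltW.
  have c2 : c ^+ 2 <= (C' * b) ^+ 2.
    rewrite /c; apply: le_trans (inner_CS y z) _; rewrite -/b.
    by rewrite exprMn [b ^+ 2]expr2 mulrCA ler_wpM2l.
  rewrite leNgt; apply/negP => cgt; move: c2.
  by rewrite leNgt ltr_pXn2r ?cgt ?nnegrE// ltW// (le_lt_trans Cb0).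
have [b_gt0|b_le0] := ltP 0 b; last first.
  by apply/inner_eq0/le_anti; rewrite b_le0 inner_ge0.
have a_ge0 : 0 <= a by rewrite subr_ge0 ge.
have a_le : a <= e * b by rewrite /a -/b; move: le; rewrite -/b; lra.
have : a * c <= (e * b) * (C' * b).
  apply: le_trans (ler_wpM2l a_ge0 c_le) _.
  by apply: ler_wpM2r => //; apply: mulr_ge0; exact: ltW.
have -> : (e * b) * (C' * b) = b ^+ 2 / 2 by rewrite /e; field; rewrite gt_eqF.
have : 0 < b ^+ 2 by rewrite exprn_gt0.
by move=> ? ?; exfalso; lra.
Qed.

(** Otherwise the numbers a with E(]-oo, a[) = 0 are bounded by the infimum of
    the spectrum. Their supremum M is attained, so it lies strictly below that
    infimum, in the resolvent set, and pvm_gap contradicts its maximality. *)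
Lemma pvm_below_spectrum x : positive_operator D A ->
  (forall l, spectrum D A l -> 0 <= l) ->
  E `]-oo, inf (spectrum D A)[%classic x = 0.
Proof.
move=> A_pos sp0; set l := inf _.
pose N : set R := [set a | forall x, E `]-oo, a[%classic x = 0].
have N_down a b : a <= b -> N b -> N a.
  move=> ab Nb y; apply: (pvm_subset_eq0 _ (m_below a) (m_below b)) => //.
  by move=> s /=; rewrite !in_itv/= => /lt_le_trans; apply.
suff : N l by apply.
apply: contrapT => Nl.
have N_le a : N a -> a <= l.
  by move=> Na; rewrite leNgt; apply/negP => /ltW /N_down /(_ Na).
have N0 : N 0 by move=> y; exact: pvm_negative_eq0.
have supN : has_sup N by split; [exists 0|exists l].
pose M := sup N.
have M0 : 0 <= M by apply: ub_le_sup => //; exists l.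
have NM : N M.
  move=> y.
  have -> : `]-oo, M[%classic = \bigcup_k (`]-oo, M - k.+1%:R^-1[%classic : set R).
    apply/seteqP; split => [s|s [k _]] /=; rewrite !in_itv/=; last first.
      by move=> /lt_le_trans; apply; rewrite gerBl invr_ge0.
    move=> sM; exists (Num.truncn (M - s)^-1) => //=.
    rewrite in_itv/= ltrBrDl addrC -ltrBrDl.
    by rewrite invf_plt ?posrE ?subr_gt0// truncnS_gt.
  apply: pvm_bigcup_eq0 => k; first exact: m_below.
  have [//|a Na Ma] := @sup_adherent _ _ k.+1%:R^-1 _ supN.
  by apply: (N_down _ a) => //; exact: ltW.
have M_lt : M < l.
  by rewrite lt_neqAle N_le// andbT; apply/eqP => Ml; apply: Nl; rewrite -Ml.
have [|e e0 NMe] := pvm_gap M0 NM.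
  apply: contrapT => M_sp; move: M_lt; rewrite ltNge => /negP; apply.
  by apply: ge_inf => //; exists 0 => a /sp0.
have : M + e <= M by apply: ub_le_sup => //; exists l.
by rewrite gerDl leNgt e0.
Qed.

End bottom_of_spectrum.

(** * The exponential of - A^2 T *)

Section damped.
Context (R : realType) (H : innerProductType R) (E : resolution_of_identity H).
Hypothesis H_complete : rapidly_complete H.
Variable T : R.
Hypothesis T_ge0 : 0 <= T.

Let g (s : R) := expR (- (s ^+ 2 * T)).

Let mg : measurable_fun setT g.
Proof.
apply: measurableT_comp => //; apply: measurableT_comp => //.
by apply: measurable_funM => //; exact: measurable_funX.
Qed.

Let g_gt0 s : 0 < g s. Proof. exact: expR_gt0. Qed.
Let g_ge0 s : 0 <= g s. Proof. exact: ltW. Qed.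

Let g_le1 s : g s <= 1.
Proof. by rewrite -expR0 ler_expR oppr_le0 mulr_ge0 ?sqr_ge0. Qed.

Let S := exp_sqr E T.

Let SE x z : '<S x, z> = spectral_form E g x z.
Proof. exact: (spectral_integralE E mg g_ge0 g_le1). Qed.

Lemma exp_sqr_linear a x y : S (a *: x + y) = a *: S x + S y.
Proof.
apply: inner_ext => z.
by rewrite innerDl innerZl !SE (spectral_form_linear E mg g_ge0 g_le1).
Qed.

Lemma exp_sqr_sym x y : '<S x, y> = '<x, S y>.
Proof. by rewrite [RHS]innerC !SE spectral_formC. Qed.

Lemma exp_sqr_ge0 x : 0 <= '<S x, x>.
Proof. by rewrite SE; exact: (spectral_form_psd E mg g_ge0 g_le1). Qed.

Lemma exp_sqr_eq0 x : '<S x, x> = 0 -> x = 0.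
Proof. by rewrite SE; exact: (spectral_form_eq0 mg g_gt0 g_le1). Qed.

Lemma exp_sqr_le (l : R) x : 0 <= l -> E `]-oo, l[%classic x = 0 ->
  '<S x, x> <= expR (- (l ^+ 2 * T)) * '<x, x>.
Proof.
move=> l0 El; rewrite SE.
have ml : measurable (`]-oo, l[%classic : set (measurableTypeR R)).
  exact: measurable_itv.
apply: (spectral_form_le (bounded_integrable E mg g_ge0 g_le1 _) ml El).
move=> s /=; rewrite in_itv/= => /negP; rewrite -leNgt => ls.
rewrite ler_expR lerN2 ler_wpM2r// ler_sqr ?nnegrE//.
exact: le_trans ls.
Qed.

End damped.

(** The argument takes place in any complete real inner product space; the
    spectrum is nonnegative because it consists of eigenvalues of a positive
    operator. *)
Lemma T_lp_properties (R : realType) (H : innerProductType R)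
    (D : set H) (A : H -> H) (E : resolution_of_identity H) (T gamma : R) :
  rapidly_complete H -> self_adjoint D A -> positive_operator D A ->
  discrete_spectrum D A -> resolution_of D A E -> 0 < T -> 0 < gamma ->
  gamma < 2 * expR (inf (spectrum D A) ^+ 2 * T) ->
  let lambda_bar := inf (spectrum D A) in
  let lambda_tilde := Num.sqrt (lambda_bar ^+ 2 - T^-1 * ln 2) in
  [/\ self_adjoint setT (T_lp E T gamma),
      non_expansive (T_lp E T gamma),
      regular_asymptotic (T_lp E T gamma),
      ~ eigenvalue_of setT (T_lp E T gamma) 1 &
      0 <= lambda_bar ^+ 2 - T^-1 * ln 2 ->
      gamma < 2 * expR (lambda_tilde ^+ 2 * T) ->
      injective (T_lp E T gamma)].
Proof.
move=> complete A_self_adjoint A_positive A_discrete E_A T_gt0 gamma_gt0.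
set l := inf (spectrum D A) => gamma_lt lambda_bar lambda_tilde.
have T_ge0 := ltW T_gt0; have gamma_ge0 := ltW gamma_gt0.
have spectrum_ge0 a : spectrum D A a -> 0 <= a.
  move=> /A_discrete[_ [x x0 [Dx Ax]] _].
  have := A_positive x Dx x0; rewrite Ax innerZl => /ltW.
  rewrite pmulr_lge0// lt_neqAle inner_ge0 andbT eq_sym.
  by apply: contra_neq x0; exact: inner_eq0.
have l_ge0 : 0 <= l.
  rewrite /l; have [->|sp0] := eqVneq (spectrum D A) set0; first by rewrite inf0.
  by apply: lb_le_inf => //; exact/set0P.
pose c := gamma * expR (- (l ^+ 2 * T)).
have cE : c = gamma / expR (l ^+ 2 * T) by rewrite /c expRN.
have c_lt2 : c < 2 by rewrite cE ltr_pdivrMr ?expR_gt0.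
pose S x := gamma *: exp_sqr E T x.
have S_linear a x y : S (a *: x + y) = a *: S x + S y.
  by rewrite /S exp_sqr_linear// scalerDr !scalerA mulrC.
have S_sym x y : '<S x, y> = '<x, S y>.
  by rewrite /S innerZl innerZr exp_sqr_sym.
have S_ge0 x : 0 <= '<S x, x> by rewrite innerZl mulr_ge0 ?exp_sqr_ge0.
have S_le x : '<S x, x> <= c * '<x, x>.
  rewrite innerZl -mulrA ler_wpM2l// exp_sqr_le//.
  exact: (pvm_below_spectrum A_self_adjoint E_A).
split.
- exact: id_sub_self_adjoint S_linear S_sym.
- exact: id_sub_non_expansive S_linear S_sym S_ge0 S_le c_lt2.
- exact: id_sub_regular_asymptotic S_linear S_sym S_ge0 S_le c_lt2.
- move=> [x x0 [_ ]]; rewrite scale1r => Lx; move/eqP: x0; apply.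
  have Sx0 : S x = 0 by apply: oppr_inj; apply: (addrI x); rewrite oppr0 addr0.
  have : gamma * '<exp_sqr E T x, x> = 0.
    by rewrite -innerZl -[gamma *: _]/(S x) Sx0 inner0l.
  move/eqP; rewrite mulf_eq0 gt_eqF//= => /eqP.
  exact: exp_sqr_eq0.
move=> tilde_ge0 gamma_lt_tilde x y Lxy.
have c_lt1 : c < 1.
  rewrite cE ltr_pdivrMr ?expR_gt0// mul1r.
  move: gamma_lt_tilde; rewrite /lambda_tilde sqr_sqrtr//.
  have -> : (lambda_bar ^+ 2 - T^-1 * ln 2) * T = l ^+ 2 * T - ln 2.
    by rewrite -/l; field; rewrite gt_eqF.
  by rewrite expRD expRN lnK ?posrE// mulrCA divff// mulr1.
pose w := x - y.
have Sw : S w = w.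
  have -> : S w = S x - S y.
    by rewrite /w addrC -scaleN1r S_linear scaleN1r addrC.
  apply/esym/eqP; rewrite -subr_eq0 opprD addrACA -opprD.
  by rewrite -[x - S x]/(T_lp E T gamma x) Lxy subrr.
have := S_le w; rewrite Sw => w_le.
apply/eqP; rewrite -subr_eq0 -/w; apply/eqP/inner_eq0/le_anti.
rewrite inner_ge0 andbT; have := inner_ge0 w; nra.
Qed.

Theorem theorem10 (R : realType) (n : nat)
    (Omega : set 'rV[R]_n) (Omega_open : open Omega)
    (Omega_bounded : bounded_set Omega) (Omega_smooth : smooth_boundary Omega)
    (D : set (L2_open Omega_open))
    (A : L2_open Omega_open -> L2_open Omega_open)
    (A_self_adjoint : self_adjoint D A)
    (A_positive : positive_operator D A)
    (A_unbounded : ~ bounded_on D A)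
    (A_discrete : discrete_spectrum D A)
    (E : resolution_of_identity (L2_open Omega_open))
    (E_A : resolution_of D A E)
    (T : R) (T_gt0 : 0 < T)
    (gamma : R) (gamma_gt0 : 0 < gamma)
    (gamma_lt : gamma < 2 * expR (inf (spectrum D A) ^+ 2 * T)) :
  let lambda_bar := inf (spectrum D A) in
  let lambda_tilde := Num.sqrt (lambda_bar ^+ 2 - T^-1 * ln 2) in
  [/\ self_adjoint setT (T_lp E T gamma),
      non_expansive (T_lp E T gamma),
      regular_asymptotic (T_lp E T gamma),
      ~ eigenvalue_of setT (T_lp E T gamma) 1 &
      0 <= lambda_bar ^+ 2 - T^-1 * ln 2 ->
      gamma < 2 * expR (lambda_tilde ^+ 2 * T) ->
      injective (T_lp E T gamma)].
Proof.
have complete : rapidly_complete (L2_open Omega_open) :=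
  @L2_rapidly_complete _ _ _ _.
exact (T_lp_properties complete A_self_adjoint A_positive A_discrete E_A
  T_gt0 gamma_gt0 gamma_lt).
Qed.
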